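(* Let $G$ be a group, let $R$ be an indecomposable commutative ring with unit and let $\mathscr G_1$, $\mathscr G_2$ be ample $G$-graded Hausdorff groupoids (here the subscripts are merely indices). If $\mathscr G_2$ satisfies the local bisection hypothesis (relative to $R$ and its grading) and there is a graded diagonal-preserving ring isomorphism $\Phi\colon R\mathscr G_1\to R\mathscr G_2$, then $\mathscr G_1$ satisfies the local bisection hypothesis (relative to $R$ and its grading).
   Context: A commutative ring $R$ with unit is indecomposable if $0\neq 1$ and $0,1$ are its only idempotents. Groupoids. A groupoid $\mathscr G$ is a small category with all arrows invertible; $\mathscr G^{(0)}$ is the set of objects (identified with the identity arrows), $\mathscr G^{(1)}$ the set of arrows, $\boldsymbol d,\boldsymbol r$ the domain and range maps; $\alpha\beta$ is defined when $\boldsymbol d(\alpha)=\boldsymbol r(\beta)$. A topological groupoid has topologies making all structure maps continuous; it is étale if $\boldsymbol d$ is a local homeomorphism (then all structure maps are, and $\mathscr G^{(0)}$ is open in $\mathscr G^{(1)}$). A Boolean space is a Hausdorff space with a basis of compact open sets. An ample groupoid is an étale groupoid with $\mathscr G^{(0)}$ a Boolean space; it is Hausdorff if $\mathscr G^{(1)}$ is Hausdorff. A local bisection is an open subset $U\subseteq\mathscr G^{(1)}$ on which $\boldsymbol d$ and $\boldsymbol r$ are injective. Gradings. A $G$-graded groupoid is a topological groupoid with a continuous functor (cocycle) $c\colon\mathscr G\to G$, $G$ being a discrete one-object groupoid. Groupoid algebra. $R\mathscr G$ is the $R$-module of compactly supported locally constant functions $\mathscr G^{(1)}\to R$ with product $fg(\gamma)=\sum_{\boldsymbol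 d(\alpha)=\boldsymbol d(\gamma)}f(\gamma\alpha^{-1})g(\alpha)$. It is $G$-graded, the component $(R\mathscr G)_g$, $g\in G$, consisting of the functions supported on $c^{-1}(g)$. The diagonal subalgebra $D(\mathscr G)$ is the set of functions supported on $\mathscr G^{(0)}$. An isomorphism $\Phi\colon R\mathscr G\to R\mathscr G'$ is diagonal-preserving if $\Phi(D(\mathscr G))=D(\mathscr G')$, and graded if $\Phi((R\mathscr G)_g)=(R\mathscr G')_g$ for all $g\in G$. Normalizer. For $g\in G$ let $N_g$ be the set of $m\in (R\mathscr G)_g$ for which there is $m'\in (R\mathscr G)_{g^{-1}}$ with $mm'm=m$, $m'mm'=m'$ and $mD(\mathscr G)m'\cup m'D(\mathscr G)m\subseteq D(\mathscr G)$. The (graded) normalizer of $D(\mathscr G)$ is $N=\bigcup_{g\in G}N_g$. $\mathscr G$ satisfies the local bisection hypothesis (relative to $R$ and the grading) if $\mathrm{supp}(m)=\{\gamma\mid m(\gamma)\ne0\}$ is a local bisection for every $m\in N$. *)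

(* Defs.v *)
From HB Require Import structures.
From mathcomp Require Import all_boot all_algebra.
From mathcomp Require Import all_classical topology.

Set Implicit Arguments.
Unset Strict Implicit.
Unset Printing Implicit Defensive.

Import GRing.Theory.

Local Open Scope classical_set_scope.
Local Open Scope ring_scope.

Definition indecomposable (R : comPzRingType) : Prop :=
  (0 : R) <> 1 /\ forall e : R, e * e = e -> e = 0 \/ e = 1.

(* [gmul a b] is the product ab, meaningful only when [gdom a = grng b]; the
   values of [gmul] on non-composable pairs are arbitrary and no axiom
   constrains them.  Objects are kept as a separate space, identified with the
   identity arrows through [gid]: this map is continuous with continuous left
   inverse [gdom], hence is a topological embedding. *)
Record topGroupoid := TopGroupoid {
  obj : topologicalType;
  arr : topologicalType;
  gdom : arr -> obj;
  grng : arr -> obj;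
  gid : obj -> arr;
  ginv : arr -> arr;
  gmul : arr -> arr -> arr;
  gdom_id : forall x, gdom (gid x) = x;
  grng_id : forall x, grng (gid x) = x;
  gdom_mul : forall a b, gdom a = grng b -> gdom (gmul a b) = gdom b;
  grng_mul : forall a b, gdom a = grng b -> grng (gmul a b) = grng a;
  gmulA : forall a b c, gdom a = grng b -> gdom b = grng c ->
    gmul a (gmul b c) = gmul (gmul a b) c;
  gmul_idl : forall a, gmul (gid (grng a)) a = a;
  gmul_idr : forall a, gmul a (gid (gdom a)) = a;
  gdom_inv : forall a, gdom (ginv a) = grng a;
  grng_inv : forall a, grng (ginv a) = gdom a;
  gmulV : forall a, gmul a (ginv a) = gid (grng a);
  gmulVl : forall a, gmul (ginv a) a = gid (gdom a);
  gdom_continuous : continuous gdom;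
  grng_continuous : continuous grng;
  gid_continuous : continuous gid;
  ginv_continuous : continuous ginv;
  gmul_continuous :
    {within [set p : arr * arr | gdom p.1 = grng p.2],
      continuous (fun p : arr * arr => gmul p.1 p.2)}
}.

(* [g] is the inverse homeomorphism f(U) -> U; its values outside f(U) are
   irrelevant. *)
Definition local_homeomorphism (X Y : topologicalType) (f : X -> Y) : Prop :=
  forall x : X, exists (U : set X) (g : Y -> X),
    [/\ open U /\ U x, open (f @` U), {within U, continuous f},
        {within f @` U, continuous g} & {in U, cancel f g}].

Definition boolean_space (X : topologicalType) : Prop :=
  hausdorff_space X /\
  exists B : set (set X), basis B /\ forall U, B U -> compact U /\ open U.

Definition etale (S : topGroupoid) : Prop := local_homeomorphism (@gdom S).

Definition ample (S : topGroupoid) : Prop := etale S /\ boolean_space (obj S).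

Definition hausdorff_groupoid (S : topGroupoid) : Prop :=
  hausdorff_space (arr S).

Definition local_bisection (S : topGroupoid) (U : set (arr S)) : Prop :=
  [/\ open U, set_inj U (@gdom S) & set_inj U (@grng S)].

(* The first clause is continuity for the discrete topology on G. *)
Definition grading (G : groupType) (S : topGroupoid) (c : arr S -> G) : Prop :=
  [/\ forall A : set G, open (c @^-1` A),
      forall x, c (gid x) = 1%g &
      forall a b, gdom a = grng b -> c (gmul a b) = (c a * c b)%g].

Section GroupoidAlgebra.
Variables (R : comPzRingType) (S : topGroupoid).
Implicit Types f g m : arr S -> R.

Definition supp f : set (arr S) := [set a | f a != 0].

Definition locally_constant f : Prop := forall a, \forall b \near a, f b = f a.

(* The support of a locally constant function is closed, so no closure is
   needed. *)
Definition groupoid_algebra : set (arr S -> R) :=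
  [set f | locally_constant f /\ compact (supp f)].

(* A finitely supported sum when S is étale and f, g are in the algebra. *)
Definition conv f g : arr S -> R :=
  fun c => \sum_(a \in [set a | gdom a = gdom c]) f (gmul c (ginv a)) * g a.

Definition diagonal : set (arr S -> R) :=
  [set f | groupoid_algebra f /\ supp f `<=` range (@gid S)].

Variables (G : groupType) (c : arr S -> G).

Definition component (g : G) : set (arr S -> R) :=
  [set f | groupoid_algebra f /\ supp f `<=` c @^-1` [set g]].

Definition normalizer_at (g : G) : set (arr S -> R) :=
  [set m | component g m /\
    exists m', [/\ component g^-1%g m',
      conv (conv m m') m = m,
      conv (conv m' m) m' = m',
      forall f, diagonal f -> diagonal (conv (conv m f) m') &
      forall f, diagonal f -> diagonal (conv (conv m' f) m)]].

Definition normalizer : set (arr S -> R) :=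
  \bigcup_(g in [set: G]) normalizer_at g.

Definition local_bisection_hypothesis : Prop :=
  forall m, normalizer m -> local_bisection (supp m).

End GroupoidAlgebra.

(* Only the restriction of [Phi] to the groupoid algebra of S1 matters.  The
   isomorphism is one of rings, not of R-algebras. *)
Definition ring_isomorphism (R : comPzRingType) (S1 S2 : topGroupoid)
    (Phi : (arr S1 -> R) -> (arr S2 -> R)) : Prop :=
  [/\ set_bij (@groupoid_algebra R S1) (@groupoid_algebra R S2) Phi,
      forall f g, groupoid_algebra f -> groupoid_algebra g ->
        Phi (f \+ g) = Phi f \+ Phi g &
      forall f g, groupoid_algebra f -> groupoid_algebra g ->
        Phi (conv f g) = conv (Phi f) (Phi g)].

Definition diagonal_preserving (R : comPzRingType) (S1 S2 : topGroupoid)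
    (Phi : (arr S1 -> R) -> (arr S2 -> R)) : Prop :=
  Phi @` @diagonal R S1 = @diagonal R S2.

Definition graded_map (R : comPzRingType) (G : groupType)
    (S1 S2 : topGroupoid) (c1 : arr S1 -> G) (c2 : arr S2 -> G)
    (Phi : (arr S1 -> R) -> (arr S2 -> R)) : Prop :=
  forall g : G, Phi @` component (R := R) c1 g = component (R := R) c2 g.

(* Main.v *)
(* Write u for the indicator function of a homogeneous compact open bisection
   U of S1.  It normalises the diagonal, so the support of Phi u is a bisection.
   If U contains no unit, then Phi u vanishes on the units of S2: restricting
   Phi u to a compact open set of units on which it is nonzero gives a diagonal
   element, whose preimage is diagonal and supported in U.  Decomposing
   functions into such pieces, Phi intertwines the restrictions to the units.

   Now let m normalise the diagonal of S1 and let m a <> 0.  Choose U containing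
   the inverse of a, with m constant on the inverses of elements of U, and cut m
   down to m2 with sources in W = r(U).  The product u * m2 is the nonzero
   constant m a on the units in W; as R is indecomposable, Phi (u * m2) is
   nonzero at every unit where Phi 1_W is.  Both Phi u and Phi m2 are supported
   on bisections, hence Phi (u * m2) is diagonal, and so is u * m2.  Likewise
   every b in the support of m2 has range in d(U).  Therefore any b with m b <> 0
   and the same source as a is the inverse of an element of U with the same range
   as the inverse of a, that is, b = a.  Injectivity of the range map on the
   support of m follows by applying this to m and to its partial inverse m'. *)
From Pilot Require Import Defs.
From mathcomp Require Import all_boot all_algebra.
From mathcomp Require Import all_classical topology.
(* [topology] shadows [Defs.diagonal]. *)
Import Pilot.Defs.

Set Implicit Arguments.
Unset Strict Implicit.
Unset Printing Implicit Defensive.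

Import GRing.Theory.

Local Open Scope classical_set_scope.
Local Open Scope ring_scope.

(** * Cancellation identities in a groupoid *)

Section GroupoidArithmetic.
Variable S : topGroupoid.
Implicit Types a b : arr S.

Lemma gmulVK a b : gdom a = grng b -> gmul (ginv a) (gmul a b) = b.
Proof. by move=> h; rewrite gmulA ?gdom_inv // gmulVl h gmul_idl. Qed.

Lemma gmulKV a b : gdom a = gdom b -> gmul (gmul a (ginv b)) b = a.
Proof. by move=> h; rewrite -gmulA ?grng_inv ?gdom_inv // gmulVl -h gmul_idr. Qed.

Lemma gdomK a b : gdom a = gdom b -> gdom (gmul a (ginv b)) = grng b.
Proof. by move=> h; rewrite gdom_mul ?grng_inv // gdom_inv. Qed.

Lemma grngK a b : gdom a = gdom b -> grng (gmul a (ginv b)) = grng a.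
Proof. by move=> h; rewrite grng_mul ?grng_inv. Qed.

Lemma ginvK a : ginv (ginv a) = a.
Proof.
rewrite -[LHS]gmul_idr gdom_inv grng_inv -gmulVl gmulA ?gdom_inv ?grng_inv //.
by rewrite gmulVl gdom_inv gmul_idl.
Qed.

Lemma gmulVKl a b : grng a = grng b -> gmul a (gmul (ginv a) b) = b.
Proof. by move=> h; rewrite -{1}(ginvK a) gmulVK ?gdom_inv. Qed.

Lemma gmulK a b : gdom a = grng b -> gmul (gmul a b) (ginv b) = a.
Proof. by move=> h; rewrite -gmulA ?grng_inv // gmulV -h gmul_idr. Qed.

Lemma ginv_id (x : obj S) : ginv (gid x) = gid x.
Proof. by rewrite -[LHS]gmul_idl grng_inv gdom_id gmulV grng_id. Qed.

Lemma gmulV_id a b z : gdom a = gdom b -> gmul a (ginv b) = gid z -> a = b.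
Proof.
move=> h e; rewrite -(gmulKV h) e.
by have := gdomK h; rewrite e gdom_id => ->; rewrite gmul_idl.
Qed.

Lemma gmulV_inv a b : gdom a = gdom b -> gmul a (ginv b) = ginv b ->
  a = gid (gdom b).
Proof. by move=> h e; rewrite -(gmulKV h) e gmulVl. Qed.

Lemma gmul_idV a b z : gdom a = grng b -> gmul a b = gid z -> b = ginv a.
Proof.
move=> h e; have := grng_mul h; rewrite e grng_id => zE.
by rewrite -(gmulVK h) e zE -gdom_inv gmul_idr.
Qed.

End GroupoidArithmetic.

(** * Topology of ample groupoids: charts, compact open bisections, units *)

Section Topology.

Lemma open_locally (T : topologicalType) (A : set T) :
  (forall x, A x -> exists B, [/\ open B, B x & B `<=` A]) -> open A.
Proof.
move=> h; rewrite openE => x /h [B [oB Bx BA]].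
by apply: filterS BA _; apply: open_nbhs_nbhs.
Qed.

Lemma openX (T U : topologicalType) (A : set T) (B : set U) :
  open A -> open B -> open (A `*` B).
Proof.
move=> oA oB; rewrite openE => -[x y] [Ax By]; exists (A, B) => //=.
by split; apply: open_nbhs_nbhs.
Qed.

Variable S : topGroupoid.
Hypothesis ampleS : ample S.

Lemma obj_basis (x : obj S) (O : set (obj S)) : open O -> O x ->
  exists K, [/\ compact K, open K, K x & K `<=` O].
Proof.
move=> oO Ox; have [_ [_ [B [[_ hB] hcB]]]] := ampleS.
have [K [BK Kx] KO] := hB x O (open_nbhs_nbhs (conj oO Ox)).
by have [? ?] := hcB K BK; exists K.
Qed.

Lemma open_gdom_preimage (A : set (obj S)) : open A -> open (@gdom S @^-1` A).
Proof. by apply: open_comp => ? _; exact: gdom_continuous. Qed.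

Lemma open_grng_preimage (A : set (obj S)) : open A -> open (@grng S @^-1` A).
Proof. by apply: open_comp => ? _; exact: grng_continuous. Qed.

Lemma open_gid_preimage (A : set (arr S)) : open A -> open (@gid S @^-1` A).
Proof. by apply: open_comp => ? _; exact: gid_continuous. Qed.

Lemma open_ginv_preimage (A : set (arr S)) : open A -> open (@ginv S @^-1` A).
Proof. by apply: open_comp => ? _; exact: ginv_continuous. Qed.

Lemma ginv_image (A : set (arr S)) : @ginv S @` A = @ginv S @^-1` A.
Proof.
apply/seteqP; split => [_ [a Aa <-]|a Aa] /=; first by rewrite ginvK.
by exists (ginv a); rewrite ?ginvK.
Qed.

(** Images are open because the local inverse [g] is continuous: inside the open set d(U), the image
    of [O] is the preimage of [O] under [g]. *)
Lemma etale_chart (a : arr S) : exists (U : set (arr S)) (g : obj S -> arr S),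
  [/\ open U, U a, {in U, cancel (@gdom S) g},
      {within (@gdom S @` U), continuous g} &
      forall O, open O -> O `<=` U -> open (@gdom S @` O)].
Proof.
have [U [g [[oU Ua] odU _ cg gK]]] := ampleS.1 a.
exists U, g; split => // O oO OU.
rewrite continuous_open_subspace // in cg.
have /(continuous_inP _ odU)/(_ _ oO) := cg.
congr open; apply/seteqP; split => [_ [[b Ub <-] /=]|_ [b Ob <-]].
  by rewrite gK ?inE // => Ob; exists b.
by split; [exists b => //; exact: OU | rewrite /= gK // inE; exact: OU].
Qed.

Lemma open_gdom_image (O : set (arr S)) : open O -> open (@gdom S @` O).
Proof.
move=> oO; apply: open_locally => _ [a Oa <-].
have [U [g [oU Ua _ _ h]]] := etale_chart a.
exists (@gdom S @` (O `&` U)); split.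
- by apply: h => [|b []//]; exact: openI.
- by exists a.
- by move=> _ [b [Ob _] <-]; exists b.
Qed.

Lemma open_grng_image (O : set (arr S)) : open O -> open (@grng S @` O).
Proof.
move=> oO; rewrite (_ : _ @` O = @gdom S @` (@ginv S @^-1` O)).
  exact/open_gdom_image/open_ginv_preimage.
apply/seteqP; split => _ [a Oa <-].
  by exists (ginv a); rewrite /= ?ginvK ?gdom_inv.
by exists (ginv a); rewrite // grng_inv.
Qed.

Definition compact_bisection (U : set (arr S)) : Prop :=
  compact U /\ local_bisection U.

(** Charts at [a] and at its inverse make source and range injective near [a]. Compactness comes
    from the objects: the bisection is the image under the local inverse [g] of a compact open set
    of objects. *)
Lemma compact_bisection_basis (a : arr S) (O : set (arr S)) : open O -> O a ->
  exists U, [/\ compact_bisection U, U a & U `<=` O].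
Proof.
move=> oO Oa.
have [U [g [oU Ua gK cg imO]]] := etale_chart a.
have [V [h [oV Va hK _ _]]] := etale_chart (ginv a).
pose O' := O `&` U `&` @ginv S @^-1` V.
have oO' : open O'.
  by apply: openI; [exact: openI | exact: open_ginv_preimage].
have O'U : O' `<=` U by move=> b [[]].
have [K [cK oK Ka KO']] : exists K, [/\ compact K, open K, K (gdom a) &
    K `<=` @gdom S @` O'].
  by apply: obj_basis; [exact: imO | exists a].
exists (O' `&` @gdom S @^-1` K); split; last by move=> b [[[]]].
- split; last split.
  + rewrite (_ : _ `&` _ = g @` K).
      apply: continuous_compact => //; apply: continuous_subspaceW cg.
      by move=> x /KO' [b /O'U Ub <-]; exists b.
    apply/seteqP; split => [b [O'b Kb]|_ [x Kx <-]].
      by exists (gdom b) => //; rewrite gK // inE; exact: O'U.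
    have [b O'b bx] := KO' _ Kx.
    by rewrite -bx gK ?inE; [split => //=; rewrite bx | exact: O'U].
  + by apply: openI => //; exact: open_gdom_preimage.
  + move=> b c; rewrite !inE => -[/O'U Ub _] [/O'U Uc _] e.
    by rewrite -(gK b) ?inE // e gK ?inE.
  + move=> b c; rewrite !inE => -[[_ Vb] _] [[_ Vc] _] e.
    rewrite -(ginvK b) -(ginvK c); congr ginv.
    by rewrite -(hK (ginv b)) ?inE // gdom_inv e -gdom_inv hK ?inE.
- by split.
Qed.

(** In a bisection around a unit, an arrow whose source unit lies in the same bisection equals that
    unit, since both have the same source. *)
Lemma open_units : open (range (@gid S)).
Proof.
apply: open_locally => _ [x _ <-].
have [U [[_ [oU idU _]] Ux _]] := compact_bisection_basis openT (I : setT (gid x)).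
exists (U `&` @gdom S @^-1` (@gid S @^-1` U)); split.
- by apply: openI => //; apply/open_gdom_preimage/open_gid_preimage.
- by split => //=; rewrite gdom_id.
- move=> a [Ua Ua']; exists (gdom a) => //; apply: idU; rewrite ?inE //.
  by rewrite gdom_id.
Qed.

Lemma gid_image_preimage (K : set (obj S)) :
  @gid S @` K = range (@gid S) `&` @gdom S @^-1` K.
Proof.
apply/seteqP; split => [_ [x Kx <-]|_ [[x _ <-]]].
  by split; [exists x | rewrite /= gdom_id].
by rewrite /= gdom_id => Kx; exists x.
Qed.

Lemma open_gid_image (K : set (obj S)) : open K -> open (@gid S @` K).
Proof.
move=> oK; rewrite gid_image_preimage; apply: openI; first exact: open_units.
exact: open_gdom_preimage.
Qed.

Lemma compact_gid_image (K : set (obj S)) : compact K -> compact (@gid S @` K).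
Proof.
move=> cK; apply: continuous_compact => //.
by apply: continuous_subspaceT; exact: gid_continuous.
Qed.

Lemma compact_gdom_image (U : set (arr S)) : compact U -> compact (@gdom S @` U).
Proof.
move=> cK; apply: continuous_compact => //.
by apply: continuous_subspaceT; exact: gdom_continuous.
Qed.

Lemma compact_grng_image (U : set (arr S)) : compact U -> compact (@grng S @` U).
Proof.
move=> cK; apply: continuous_compact => //.
by apply: continuous_subspaceT; exact: grng_continuous.
Qed.

Lemma compact_bisection_inv (U : set (arr S)) :
  compact_bisection U -> compact_bisection (@ginv S @^-1` U).
Proof.
move=> [cU [oU idU irU]]; split; last split.
- rewrite -ginv_image; apply: continuous_compact => //.
  by apply: continuous_subspaceT; exact: ginv_continuous.
- exact: open_ginv_preimage.
- move=> a b; rewrite !inE /= => Ua Ub e.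
  rewrite -(ginvK a) -(ginvK b); congr ginv.
  by apply: irU; rewrite ?inE // !grng_inv.
- move=> a b; rewrite !inE /= => Ua Ub e.
  rewrite -(ginvK a) -(ginvK b); congr ginv.
  by apply: idU; rewrite ?inE // !gdom_inv.
Qed.

Lemma compact_bisectionI (U C : set (arr S)) :
  compact_bisection U -> open C -> closed C -> compact_bisection (U `&` C).
Proof.
move=> [cU [oU idU irU]] oC cC; split; last split.
- exact: compact_closedI.
- exact: openI.
- by move=> a b; rewrite !inE => -[Ua _] [Ub _]; apply: idU; rewrite inE.
- by move=> a b; rewrite !inE => -[Ua _] [Ub _]; apply: irU; rewrite inE.
Qed.

Lemma closed_obj (K : set (obj S)) : compact K -> closed K.
Proof. by apply: compact_closed; have [_ []] := ampleS. Qed.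

(** The object space is Hausdorff. It follows that the composable part of a compact set of pairs is
    compact, which controls the support of a product. *)
Lemma closed_composable :
  closed [set p : arr S * arr S | gdom p.1 = grng p.2].
Proof.
rewrite -openC; apply: open_locally => -[a b] /= /eqP ab.
have [_ [hO _]] := ampleS; rewrite open_hausdorff in hO.
have [[A B] /= [Aa Bb] [oA oB /eqP AB0]] := hO _ _ ab.
rewrite !inE in Aa Bb.
exists ((@gdom S @^-1` A) `*` (@grng S @^-1` B)); split.
- by apply: openX; [exact: open_gdom_preimage | exact: open_grng_preimage].
- by [].
- move=> [c d] [/= Ac Bd] e; suff : (A `&` B) (gdom c) by rewrite AB0.
  by split => //; rewrite e.
Qed.

End Topology.

(** * Convolution with factors supported on units or on bisections *)

Section Convolution.
Variables (R : comPzRingType) (S : topGroupoid).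
Implicit Types (f g p : arr S -> R) (A U : set (arr S)).

(** Applied to a constant function, this gives multiples of indicator functions. *)
Definition cut f A : arr S -> R := fun x => if x \in A then f x else 0.

Lemma cutT f A a : A a -> cut f A a = f a.
Proof. by move=> Aa; rewrite /cut mem_set. Qed.

Lemma cutF f A a : ~ A a -> cut f A a = 0.
Proof. by move=> Aa; rewrite /cut memNset. Qed.

Lemma cut_neq0 f A a : cut f A a != 0 -> A a /\ f a != 0.
Proof.
have [Aa|nAa] := pselect (A a); first by rewrite cutT.
by rewrite cutF // eqxx.
Qed.

Lemma supp_cut f A : supp (cut f A) = A `&` supp f.
Proof.
by apply/seteqP; split => a; [exact: cut_neq0 | case=> Aa; rewrite /supp /= cutT].
Qed.

Lemma mulr_neq0_both (x y : R) : x * y != 0 -> x != 0 /\ y != 0.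
Proof. by split; apply: contra_neq H => ->; rewrite ?mul0r ?mulr0. Qed.

(** A sum with infinitely many nonzero terms is 0 by convention; here at most one term survives, so
    finiteness is automatic. *)
Lemma conv_single f g a b : gdom b = gdom a ->
  (forall x, gdom x = gdom a -> f (gmul a (ginv x)) != 0 -> g x != 0 -> x = b) ->
  conv f g a = f (gmul a (ginv b)) * g b.
Proof.
move=> ba h; rewrite /conv -(fsbig_widen [set b]) ?fsbig_set1 //.
  by move=> _ ->.
move=> x [/= xa xb]; apply: contrapT => /eqP/mulr_neq0_both[fx gx].
exact/xb/h.
Qed.

Lemma conv_neq0 f g a : conv f g a != 0 ->
  exists x, [/\ gdom x = gdom a, f (gmul a (ginv x)) != 0 & g x != 0].
Proof.
move=> h; apply: contrapT => nx; case/eqP: h; apply: fsbig1 => x xa.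
apply: contrapT => /eqP/mulr_neq0_both[fx gx]; apply: nx.
by exists x.
Qed.

Lemma conv_eq0 f g a :
  (forall x, gdom x = gdom a -> f (gmul a (ginv x)) != 0 -> g x != 0 -> False) ->
  conv f g a = 0.
Proof. by move=> h; apply: contrapT => /eqP/conv_neq0[x [? ? ?]]; exact: (h x). Qed.

Lemma conv_diagr f p a : supp p `<=` range (@gid S) ->
  conv f p a = f a * p (gid (gdom a)).
Proof.
move=> hp; rewrite (@conv_single _ _ _ (gid (gdom a))) ?gdom_id //.
  by rewrite ginv_id gmul_idr.
by move=> x xa _ /hp[y _ xE]; rewrite -xa -xE gdom_id.
Qed.

Lemma conv_diagl f p a : supp p `<=` range (@gid S) ->
  conv p f a = p (gid (grng a)) * f a.
Proof.
move=> hp; rewrite (@conv_single _ _ _ a) ?gmulV //.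
by move=> x xa /hp[y _ /esym xE] _; rewrite (gmulV_id (esym xa) xE).
Qed.

(** A middle factor supported on the units only rescales, so both sums agree term by term and no
    sums are interchanged. *)
Lemma conv_diag_assoc f p g : supp p `<=` range (@gid S) ->
  conv (conv f p) g = conv f (conv p g).
Proof.
move=> hp; apply/funext => a; apply: eq_fsbigr => x; rewrite inE /= => xa.
by rewrite conv_diagr // conv_diagl // gdomK // mulrA.
Qed.

(* Since [grng] is injective on [supp f], only the term x = b^-1 a survives. *)
Lemma conv_injl f g a b : set_inj (supp f) (@grng S) ->
  f b != 0 -> grng b = grng a -> conv f g a = f b * g (gmul (ginv b) a).
Proof.
move=> rinj fb ba.
have dE : gdom (gmul (ginv b) a) = gdom a by rewrite gdom_mul ?gdom_inv.
have aE : gmul a (ginv (gmul (ginv b) a)) = b.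
  by rewrite -{1}(gmulVKl ba) gmulK // grng_mul ?gdom_inv ?grng_inv.
rewrite (@conv_single _ _ _ (gmul (ginv b) a)) ?aE // => x xa fx _.
have <- : gmul a (ginv x) = b by apply: rinj; rewrite ?inE // grngK.
by rewrite -{2}(gmulKV (esym xa)) gmulVK // gdomK.
Qed.

Lemma conv_injr f g a b : set_inj (supp g) (@gdom S) ->
  g b != 0 -> gdom b = gdom a -> conv f g a = f (gmul a (ginv b)) * g b.
Proof.
move=> dinj gb ba; apply: conv_single => // x xa _ gx.
by apply: dinj; rewrite ?inE // xa ba.
Qed.

End Convolution.

(** * Closure properties of the groupoid algebra and decomposition over bisections *)

Section Algebra.
Variables (R : comPzRingType) (S : topGroupoid).
Hypotheses (ampleS : ample S) (hausS : hausdorff_groupoid S).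
Implicit Types (f g p : arr S -> R) (A U : set (arr S)).

Lemma locally_constant_intro f :
  (forall a, exists B, [/\ open B, B a & forall b, B b -> f b = f a]) ->
  locally_constant f.
Proof.
move=> h a; have [B [oB Ba fB]] := h a.
by apply: filterS fB _; apply: open_nbhs_nbhs.
Qed.

Lemma open_fiber f v : locally_constant f -> open [set a | f a = v].
Proof. by move=> lf; rewrite openE => a /= <-; exact: lf. Qed.

Lemma open_supp f : locally_constant f -> open (supp f).
Proof.
move=> lf; rewrite openE => a /= fa; rewrite /interior.
by apply: filterS (lf a) => b; rewrite /supp /= => ->.
Qed.

Lemma closed_supp f : locally_constant f -> closed (supp f).
Proof.
move=> lf; rewrite -openC; rewrite (_ : ~` _ = [set a | f a = 0]).
  exact: open_fiber.
apply/seteqP; split => a; rewrite /supp /=; first by move/negP/negPn/eqP.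
by move=> ->; rewrite eqxx.
Qed.

Lemma algebra_sub f g : groupoid_algebra f -> locally_constant g ->
  supp g `<=` supp f -> groupoid_algebra g.
Proof.
by move=> [_ cf] lg gf; split => //; apply: subclosed_compact cf gf; exact: closed_supp.
Qed.

Lemma locally_constant_cut f A : locally_constant f -> open A -> closed A ->
  locally_constant (cut f A).
Proof.
move=> lf oA cA; apply: locally_constant_intro => a.
have [Aa|nAa] := pselect (A a).
  exists (A `&` [set b | f b = f a]); split => //.
    by apply: openI => //; exact: open_fiber.
  by move=> b [Ab fb]; rewrite !cutT.
exists (~` A); split => //; first by rewrite openC.
by move=> b nAb; rewrite !cutF.
Qed.

Lemma algebra_cut f A : groupoid_algebra f -> open A -> closed A ->
  groupoid_algebra (cut f A).
Proof.
move=> hf oA cA; apply: (algebra_sub hf).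
  by apply: locally_constant_cut => //; case: hf.
by rewrite supp_cut => a [].
Qed.

Lemma algebra_const (v : R) A : compact A -> open A ->
  groupoid_algebra (cut (fun=> v) A).
Proof.
move=> cA oA; have lc : locally_constant (cut (fun=> v) A).
  apply: locally_constant_cut => //; last exact: compact_closed.
  by move=> a; apply: nearW.
split => //; apply: subclosed_compact cA _; first exact: closed_supp.
by rewrite supp_cut => a [].
Qed.

Lemma algebra0 : groupoid_algebra ((fun=> 0) : arr S -> R).
Proof.
split; first by move=> a; apply: nearW.
rewrite (_ : supp _ = set0); first exact: compact0.
by apply/seteqP; split => // a; rewrite /supp /= eqxx.
Qed.

Lemma algebraD f g : groupoid_algebra f -> groupoid_algebra g ->
  groupoid_algebra (f \+ g).
Proof.
move=> [lf cf] [lg cg].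
have lfg : locally_constant (f \+ g).
  move=> a; apply: filterS2 (lf a) (lg a) => b /= -> -> //.
split => //; apply: subclosed_compact (compactU cf cg) _; first exact: closed_supp.
move=> a; rewrite /supp /= => fga; apply: contrapT => /not_orP[].
move=> /negP/negPn/eqP fa /negP/negPn/eqP ga.
by rewrite fa ga addr0 eqxx in fga.
Qed.

Lemma algebra_conv_diag f p : groupoid_algebra f -> diagonal p ->
  groupoid_algebra (conv f p).
Proof.
move=> hf [[lp _] hp].
apply: (algebra_sub hf); last first.
  by move=> a; rewrite /supp /= conv_diagr // => /mulr_neq0_both[].
case: hf => lf _; apply: locally_constant_intro => a.
exists ([set b | f b = f a] `&`
  @gdom S @^-1` (@gid S @^-1` [set b | p b = p (gid (gdom a))])); split => //.
  apply: openI; first exact: open_fiber.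
  exact/open_gdom_preimage/open_gid_preimage/open_fiber.
by move=> b [/= fb pb]; rewrite !conv_diagr // fb pb.
Qed.

Lemma algebra_diag_conv p f : groupoid_algebra f -> diagonal p ->
  groupoid_algebra (conv p f).
Proof.
move=> hf [[lp _] hp].
apply: (algebra_sub hf); last first.
  by move=> a; rewrite /supp /= conv_diagl // => /mulr_neq0_both[].
case: hf => lf _; apply: locally_constant_intro => a.
exists ([set b | f b = f a] `&`
  @grng S @^-1` (@gid S @^-1` [set b | p b = p (gid (grng a))])); split => //.
  apply: openI; first exact: open_fiber.
  exact/open_grng_preimage/open_gid_preimage/open_fiber.
by move=> b [/= fb pb]; rewrite !conv_diagl // fb pb.
Qed.

Lemma diagonal_const (v : R) (K : set (obj S)) : compact K -> open K ->
  diagonal (cut (fun=> v) (@gid S @` K)).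
Proof.
move=> cK oK; split.
  by apply: algebra_const; [exact: compact_gid_image | exact: open_gid_image].
by rewrite supp_cut => _ [[x _ <-] _]; exists x.
Qed.

Lemma conv_ind (nz : (0 : R) <> 1) U f a b : set_inj U (@grng S) ->
  U b -> grng b = grng a -> conv (cut (fun=> 1) U) f a = f (gmul (ginv b) a).
Proof.
move=> rinj Ub ba; have /eqP nz1 : (1 : R) <> 0 by move/esym.
rewrite (@conv_injl _ _ _ _ _ b) ?cutT ?mul1r //.
by move=> x y; rewrite supp_cut !inE => -[Ux _] [Uy _]; apply: rinj; rewrite inE.
Qed.

Lemma conv_ind_out U f a : ~ (@grng S @` U) (grng a) ->
  conv (cut (fun=> 1) U) f a = 0.
Proof.
move=> h; apply: conv_eq0 => x xa /cut_neq0[Ux _] _; apply: h.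
by exists (gmul a (ginv x)); rewrite // grngK.
Qed.

(** Over the clopen set r(U) of ranges, the product is [f] translated by the inverse of the unique
    arrow of [U] with the given range, which varies continuously; elsewhere it vanishes. *)
Lemma algebra_conv_ind (nz : (0 : R) <> 1) U f : compact_bisection U ->
  groupoid_algebra f -> groupoid_algebra (conv (cut (fun=> 1) U) f).
Proof.
move=> [cU [oU idU irU]] [lf cf].
have lc : locally_constant (conv (cut (fun=> 1) U) f).
  apply: locally_constant_intro => a.
  have [[b Ub ba]|na] := pselect ((@grng S @` U) (grng a)); last first.
    exists (~` (@grng S @^-1` (@grng S @` U))); split => //.
      rewrite preimage_setC; apply: open_grng_preimage.
      by rewrite openC; apply: closed_obj => //; exact: compact_grng_image.
    by move=> c nc; rewrite !conv_ind_out.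
  have /subspace_continuousP mc := @gmul_continuous S.
  have nV : nbhs (gmul (ginv b) a) [set c | f c = f (gmul (ginv b) a)].
    exact: lf.
  (* Multiplication is continuous at the composable pair (b^-1, a), so [f] is constant on products
     of nearby composable pairs. *)
  have [[A0 B0] /= [nA nB] sub] := mc (ginv b, a)
    (etrans (gdom_inv b) ba) _ nV.
  exists (B0° `&` @grng S @^-1` (@grng S @` (U `&` @ginv S @^-1` A0°))); split.
  - apply: openI; first exact: open_interior.
    apply/open_grng_preimage/open_grng_image => //; apply: openI => //.
    by apply: open_ginv_preimage; exact: open_interior.
  - by split => //; exists b.
  - move=> c [/interior_subset Bc [d [Ud /interior_subset Ad] dc]].
    rewrite (@conv_ind _ _ _ _ d) // (@conv_ind _ _ _ _ b) //.
    by apply: (sub (ginv d, c)) => //=; rewrite gdom_inv.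
split => //.
(* The support lies in the image under multiplication of the compact set of composable pairs in U x
   supp f. *)
pose C := [set q : arr S * arr S | gdom q.1 = grng q.2].
have cK : compact ((fun q : arr S * arr S => gmul q.1 q.2) @`
    ((U `*` supp f) `&` C)).
  apply: continuous_compact; last first.
    by apply: compact_closedI; [exact: compact_setX | exact: closed_composable].
  by apply: continuous_subspaceW (@gmul_continuous S) => q [].
apply: subclosed_compact cK _; first exact: closed_supp.
move=> a /conv_neq0[x [xa /cut_neq0[Ux _] fx]].
by exists (gmul a (ginv x), x); rewrite /= ?gmulKV //; split; [split|exact: gdomK].
Qed.

(** Since supp f is compact and [f] and the degree are locally constant, [f] is assembled from
    finitely many constants on homogeneous compact open bisections. *)
Lemma algebra_induction (G : groupType) (c : arr S -> G) (hc : grading c)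
    (P : (arr S -> R) -> Prop) f : groupoid_algebra f ->
  P (fun=> 0) ->
  (forall g h, groupoid_algebra g -> groupoid_algebra h ->
    P g -> P h -> P (g \+ h)) ->
  (forall U v x, compact_bisection U -> U `<=` c @^-1` [set x] ->
    U `<=` supp f -> P (cut (fun=> v) U)) ->
  P f.
Proof.
move=> hf P0 PD PU; have [lf cf] := hf.
(* Asking for all clopen subsets [D] makes the property hereditary, so that a union can be split
   into two disjoint pieces. *)
pose good C := [/\ open C, closed C &
  forall D, open D -> closed D -> D `<=` C -> P (cut f D)].
have good0 : good set0.
  split; [exact: open0 | exact: closed0 | move=> D _ _ D0].
  rewrite (_ : cut f D = fun=> 0) //; apply/funext => a.
  by rewrite cutF // => /D0.
have goodU C C' : good C -> good C' -> good (C `|` C').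
  move=> [oC cC hC] [oC' cC' hC']; split; [exact: openU | exact: closedU |].
  move=> D oD cD DCC.
  have -> : cut f D = cut f (D `&` C) \+ cut f (D `\` C).
    apply/funext => a /=; have [Da|nDa] := pselect (D a); last first.
      by rewrite !cutF ?addr0 //; case.
    rewrite cutT //; have [Ca|nCa] := pselect (C a).
      by rewrite cutT // cutF ?addr0 //; case.
    by rewrite cutF ?add0r ?cutT //; case.
  have o1 : open (D `&` C) by exact: openI.
  have c1 : closed (D `&` C) by exact: closedI.
  have o2 : open (D `\` C) by apply: openI => //; rewrite openC.
  have c2 : closed (D `\` C) by apply: closedI => //; rewrite closedC.
  apply: PD; [exact: algebra_cut | exact: algebra_cut | |].
    by apply: hC => // a [].
  by apply: hC' => // a [Da nCa]; have [] := DCC a Da.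
have goodloc a : supp f a -> exists2 C, good C & C a.
  move=> fa.
  have [|//|U [bU Ua UO]] := @compact_bisection_basis _ ampleS a
      ([set b | f b = f a] `&` c @^-1` [set c a]).
    by apply: openI; [exact: open_fiber | case: hc => h _ _; exact: h].
  have [cU [oU _ _]] := bU.
  exists U => //; split => //; first exact: compact_closed.
  move=> D oD cD DU.
  rewrite (_ : cut f D = cut (fun=> f a) (U `&` D)).
    apply: (PU _ _ (c a)).
    - exact: compact_bisectionI.
    - by move=> b [/UO[]].
    - by move=> b [/UO[/= fb _] _]; rewrite /supp /= fb.
  have -> : U `&` D = D by apply/setIidPr.
  apply/funext => b; have [Db|nDb] := pselect (D b); last by rewrite !cutF.
  by rewrite !cutT //; have [] := UO _ (DU _ Db).
(* Good sets are stable under binary union, so this is a filter. Compactness in near-covering form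
   then yields one good set containing supp f. *)
pose F : set_system (set (arr S)) :=
  filter_from good (fun C => [set X | C `<=` X]).
have FF : Filter F.
  apply: filter_from_filter; first by exists set0.
  move=> C C' gC gC'; exists (C `|` C'); first exact: goodU.
  by move=> X CX; split; apply: subset_trans CX; [exact: subsetUl|exact: subsetUr].
have [|C gC CX] := (compact_near_coveringP _).1 cf _ F (fun X a => X a) FF.
  move=> a fa; have [C gC Ca] := goodloc a fa; have [oC _ _] := gC.
  exists (C, [set X | C `<=` X]); first split => /=.
  - by apply: open_nbhs_nbhs.
  - by exists C.
  - by move=> [b X] [/= Cb CX]; exact: CX.
have [oC cC hC] := gC.
rewrite (_ : f = cut f C); first exact: hC.
apply/funext => a; have [Ca|nCa] := pselect (C a); first by rewrite cutT.
rewrite cutF //; apply: contrapT => /eqP fa; apply: nCa.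
exact: (CX C).
Qed.

End Algebra.

(** * Normalizers of the diagonal *)

Section Normalizer.
Variables (R : comPzRingType) (S : topGroupoid).
Hypotheses (ampleS : ample S) (hausS : hausdorff_groupoid S).
Hypothesis nz : (0 : R) <> 1.
Variables (G : groupType) (c : arr S -> G).
Hypothesis hc : grading c.
Implicit Types (f m : arr S -> R) (U : set (arr S)).


Lemma grading_inv a : c (ginv a) = (c a)^-1%g.
Proof.
case: hc => _ c1 cM; apply: (mulIg (c a)).
by rewrite -cM ?gdom_inv // gmulVl c1 mulVg.
Qed.

(** A nonzero term writes the arrow as g h^-1 with g, h in [U] of equal source; then g = h and the
    arrow is a unit. *)
Lemma conv_ind_inv U : compact_bisection U ->
  conv (cut (fun=> 1) U) (cut (fun=> 1) (@ginv S @^-1` U)) =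
  cut (fun=> 1) (@gid S @` (@grng S @` U)) :> (_ -> R).
Proof.
move=> [cU [oU idU irU]]; apply/funext => a.
have [[_ [b Ub <-] <-]|na] := pselect ((@gid S @` (@grng S @` U)) a).
  rewrite cutT; last by exists (grng b) => //; exists b.
  rewrite (@conv_ind _ _ nz _ _ _ b) ?grng_id // -gdom_inv gmul_idr cutT //=.
  by rewrite ginvK.
rewrite cutF //; apply: conv_eq0 => x xa /cut_neq0[U1 _] /cut_neq0[U2 _].
apply: na; exists (grng (ginv x)); first by exists (ginv x).
rewrite grng_inv; apply/esym/gmulV_inv => //.
by apply: idU; rewrite ?inE // gdomK // gdom_inv.
Qed.

Lemma conv_ind_invK U : compact_bisection U ->
  conv (conv (cut (fun=> 1) U) (cut (fun=> 1) (@ginv S @^-1` U)))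
    (cut (fun=> 1) U) = cut (fun=> 1) U :> (_ -> R).
Proof.
move=> bU; rewrite conv_ind_inv //; apply/funext => a.
rewrite conv_diagl; last by rewrite supp_cut => _ [[x _ <-] _]; exists x.
have [Ua|nUa] := pselect (U a); last by rewrite (cutF _ nUa) mulr0.
by rewrite cutT ?mul1r //; exists (grng a) => //; exists a.
Qed.

Lemma diagonal_conj_ind U f : compact_bisection U -> diagonal f ->
  diagonal (conv (conv (cut (fun=> 1) U) f) (cut (fun=> 1) (@ginv S @^-1` U))).
Proof.
move=> bU hf; have [cU [oU idU irU]] := bU; split.
  rewrite conv_diag_assoc; last by case: hf.
  apply: algebra_conv_ind => //; apply: algebra_diag_conv => //.
  by have [cV [oV _ _]] := compact_bisection_inv bU; exact: algebra_const.
move=> a /conv_neq0[x [xa h1 /cut_neq0[U2 _]]].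
move: h1; rewrite conv_diagr; last by case: hf.
move=> /mulr_neq0_both[/cut_neq0[U1 _] _].
exists (gdom x) => //; apply/esym/gmulV_inv => //.
by apply: idU; rewrite ?inE // gdomK // gdom_inv.
Qed.

(** The partial inverse is the indicator of the inverse bisection. *)
Lemma normalizer_at_ind U x : compact_bisection U -> U `<=` c @^-1` [set x] ->
  normalizer_at c x (cut (fun=> 1) U : _ -> R).
Proof.
move=> bU Ux; have [cU [oU _ _]] := bU.
have bV := compact_bisection_inv bU; have [cV [oV _ _]] := bV.
have VK : @ginv S @^-1` (@ginv S @^-1` U) = U.
  by apply/funext => a; rewrite /preimage /= ginvK.
split.
  by split; [exact: algebra_const | rewrite supp_cut => a [/Ux]].
exists (cut (fun=> 1) (@ginv S @^-1` U)); split.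
- split; first exact: algebra_const.
  by rewrite supp_cut => a [/Ux /=]; rewrite grading_inv => <-; rewrite invgK.
- exact: conv_ind_invK.
- by have := conv_ind_invK bV; rewrite VK.
- by move=> f; exact: diagonal_conj_ind.
- by move=> f hf; have := diagonal_conj_ind bV hf; rewrite VK.
Qed.

(** The indicator of the units in d(supp m) is a right unit for [m], so the product is a conjugate
    of a diagonal element. *)
Lemma diagonal_conv_inverse m m' : groupoid_algebra m ->
  (forall f, diagonal f -> diagonal (conv (conv m f) m')) ->
  diagonal (conv m m').
Proof.
move=> [lm cm] h; have om := open_supp lm.
rewrite -[X in conv X m'](_ : conv m (cut (fun=> 1)
    (@gid S @` (@gdom S @` supp m))) = _).
  apply/h/diagonal_const => //; first exact: compact_gdom_image.
  exact: open_gdom_image.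
apply/funext => a.
rewrite conv_diagr; last by rewrite supp_cut => _ [[x _ <-] _]; exists x.
have [/eqP ->|ma] := boolP (m a == 0); first by rewrite mul0r.
by rewrite cutT ?mulr1 //; exists (gdom a) => //; exists a.
Qed.

End Normalizer.

(** * Transport along the isomorphism and injectivity on supports of normalizers *)

Section Isomorphism.
Variables (G : groupType) (R : comPzRingType) (S1 S2 : topGroupoid).
Variables (c1 : arr S1 -> G) (c2 : arr S2 -> G).
Hypothesis hR : indecomposable R.
Hypotheses (ample1 : ample S1) (ample2 : ample S2).
Hypotheses (haus1 : hausdorff_groupoid S1) (haus2 : hausdorff_groupoid S2).
Hypothesis hc1 : grading c1.
Hypothesis lbh2 : local_bisection_hypothesis R c2.
Variable Phi : (arr S1 -> R) -> (arr S2 -> R).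
Hypothesis Phi_iso : ring_isomorphism Phi.
Hypothesis Phi_diag : diagonal_preserving Phi.
Hypothesis Phi_graded : graded_map c1 c2 Phi.

Let nz : (0 : R) <> 1. Proof. by case: hR. Qed.

Lemma Phi_algebra f : groupoid_algebra f -> groupoid_algebra (Phi f).
Proof. by case: Phi_iso => -[h _ _] _ _; exact: h. Qed.

Lemma Phi_inj f g : groupoid_algebra f -> groupoid_algebra g ->
  Phi f = Phi g -> f = g.
Proof. by case: Phi_iso => -[_ h _] _ _ hf hg; apply: h; rewrite inE. Qed.

Lemma Phi_add f g : groupoid_algebra f -> groupoid_algebra g ->
  Phi (f \+ g) = Phi f \+ Phi g.
Proof. by case: Phi_iso => _ h _; exact: h. Qed.

Lemma Phi_conv f g : groupoid_algebra f -> groupoid_algebra g ->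
  Phi (conv f g) = conv (Phi f) (Phi g).
Proof. by case: Phi_iso => _ _ h; exact: h. Qed.

Lemma Phi0 : Phi (fun=> 0) = fun=> 0.
Proof.
have a0 := @algebra0 R S1; have := Phi_add a0 a0.
have -> : (fun=> 0) \+ (fun=> 0) = (fun=> 0) :> (arr S1 -> R).
  by apply/funext => a /=; rewrite addr0.
move=> h; apply/funext => a; have /= := congr1 (fun f => f a) h.
by move/eqP; rewrite -subr_eq subrr eq_sym => /eqP.
Qed.

Lemma Phi_diagonal f : diagonal f -> diagonal (Phi f).
Proof. by move=> hf; rewrite -Phi_diag; exists f. Qed.

Lemma diagonal_Phi p : diagonal p -> exists2 f, diagonal f & Phi f = p.
Proof. by rewrite -{1}Phi_diag. Qed.

Lemma Phi_diagonal_inv f : groupoid_algebra f -> diagonal (Phi f) -> diagonal f.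
Proof.
move=> hf /diagonal_Phi[g hg /Phi_inj <-//].
by case: hg.
Qed.

Lemma Phi_component x f : component c1 x f -> component c2 x (Phi f).
Proof. by move=> hf; rewrite -Phi_graded; exists f. Qed.

(** [Phi_conv] requires factors in the algebra; for m m' and m' m this holds because both are
    diagonal. *)
Lemma Phi_normalizer_at x m : normalizer_at c1 x m -> normalizer_at c2 x (Phi m).
Proof.
move=> [cm [m' [cm' e1 e2 d1 d2]]].
have [[am _] [am' _]] := (cm, cm').
have [amm' _] := diagonal_conv_inverse ample1 haus1 am d1.
have [am'm _] := diagonal_conv_inverse ample1 haus1 am' d2.
split; first exact: Phi_component.
exists (Phi m'); split.
- exact: Phi_component.
- by rewrite -!Phi_conv // e1.
- by rewrite -!Phi_conv // e2.
- move=> _ /diagonal_Phi[f hf <-]; have [af _] := hf.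
  rewrite -!Phi_conv //; last exact: algebra_conv_diag.
  exact/Phi_diagonal/d1.
- move=> _ /diagonal_Phi[f hf <-]; have [af _] := hf.
  rewrite -!Phi_conv //; last exact: algebra_conv_diag.
  exact/Phi_diagonal/d2.
Qed.

Lemma Phi_local_bisection x m : normalizer_at c1 x m ->
  local_bisection (supp (Phi m)).
Proof. by move=> hm; apply: lbh2; exists x => //; exact: Phi_normalizer_at. Qed.

Lemma Phi_ind_off_units U x (y : obj S2) : compact_bisection U ->
  U `<=` c1 @^-1` [set x] -> (forall z, ~ U (gid z)) ->
  Phi (cut (fun=> 1) U) (gid y) = 0.
Proof.
move=> bU Ux Un; set u := cut _ U; set n := Phi u.
have hu : normalizer_at c1 x u by exact: normalizer_at_ind.
have [on idn _] := Phi_local_bisection hu.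
have au : groupoid_algebra u by case: hu => -[].
have an : groupoid_algebra n := Phi_algebra au.
apply: contrapT => /eqP ny.
have [|//|K [cK oK Ky Kn]] :=
  @obj_basis _ ample2 y (@gid S2 @^-1` supp n).
  exact: open_gid_preimage.
pose s : arr S2 -> R := cut (fun=> 1) (@gid S2 @` K).
have ds : diagonal s by exact: diagonal_const.
have dns : diagonal (conv n s).
  split; first exact: algebra_conv_diag.
  move=> a; rewrite /supp /= conv_diagr; last by case: ds.
  move=> /mulr_neq0_both[na /cut_neq0[[z Kz za] _]].
  (* Both [a] and its source unit lie in supp n, where the source map is injective. *)
  exists (gdom a) => //; apply: idn; rewrite ?inE ?gdom_id //.
  by rewrite -za; exact: Kn.
have [t dt ts] := diagonal_Phi ds; have [at_ ht] := dt.
have E : conv n s = Phi (conv u t) by rewrite Phi_conv // ts.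
have dut : diagonal (conv u t).
  by apply: Phi_diagonal_inv; [exact: algebra_conv_diag | rewrite -E].
(* The support lies both in [U] and in the units, which are disjoint. *)
have ut0 : conv u t = fun=> 0.
  apply/funext => a; apply: contrapT => /eqP uta.
  have [z _ za] := dut.2 a uta; move: uta; rewrite conv_diagr //.
  by move=> /mulr_neq0_both[/cut_neq0[]]; rewrite -za => /Un.
have := congr1 (fun f => f (gid y)) E; rewrite ut0 Phi0 conv_diagr; last by case: ds.
by rewrite gdom_id /s cutT ?mulr1; [move/eqP; apply/negP | exists y].
Qed.

(* [Phi] commutes with the conditional expectation onto the diagonal. *)
Lemma Phi_off_units f (y : obj S2) : groupoid_algebra f ->
  (forall z, f (gid z) = 0) -> Phi f (gid y) = 0.
Proof.
move=> af f0; apply: (algebra_induction ample1 haus1 hc1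
  (P := fun h => Phi h (gid y) = 0) af).
- by rewrite Phi0.
- by move=> g h ag ah g0 h0; rewrite Phi_add //= g0 h0 addr0.
move=> U v x bU Ux Uf; have [cU [oU idU irU]] := bU.
pose p : arr S1 -> R := cut (fun=> v) (@gid S1 @` (@gdom S1 @` U)).
have dp : diagonal p.
  by apply: diagonal_const => //; [exact: compact_gdom_image | exact: open_gdom_image].
(* [Phi] need not be R-linear, so the scalar [v] is moved into a diagonal factor. *)
have -> : cut (fun=> v) U = conv (cut (fun=> 1) U) p.
  apply/funext => a; rewrite conv_diagr; last by case: dp.
  have [Ua|nUa] := pselect (U a); last by rewrite !(cutF _ nUa) mul0r.
  by rewrite /p !cutT ?mul1r //; exists (gdom a) => //; exists a.
rewrite Phi_conv; [|exact: algebra_const|by case: dp].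
rewrite conv_diagr; last by case: (Phi_diagonal dp).
rewrite (@Phi_ind_off_units U x) ?mul0r // => z /Uf.
by rewrite /supp /= f0 eqxx.
Qed.

(** Let [P] be the indicator of the support of Phi (v 1_W). Its preimage [t] is a diagonal
    idempotent, so its values at units are 0 or 1; as [t] fixes v 1_W and v is nonzero, [t] is 1 on
    [W]. Hence [t] fixes 1_W too, and Phi 1_W vanishes wherever [P] does. *)
Lemma Phi_const_neq0 (v : R) (W : set (obj S1)) (y : obj S2) :
  v != 0 -> compact W -> open W ->
  Phi (cut (fun=> 1) (@gid S1 @` W)) (gid y) != 0 ->
  Phi (cut (fun=> v) (@gid S1 @` W)) (gid y) != 0.
Proof.
move=> v0 cW oW wy; apply/eqP => py.
have dw : diagonal (cut (fun=> 1 : R) (@gid S1 @` W)) by exact: diagonal_const.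
have dv : diagonal (cut (fun=> v) (@gid S1 @` W)) by exact: diagonal_const.
set w := cut _ _ in wy dw; set p := Phi _ in py.
have [[lp cp] hp] : diagonal p by exact: Phi_diagonal.
pose P : arr S2 -> R := cut (fun=> 1) (supp p).
have dP : diagonal P.
  by split; [apply: algebra_const => //; exact: open_supp | rewrite supp_cut => a [/hp]].
have [t dt tP] := diagonal_Phi dP; have [at_ ht] := dt.
have tt : conv t t = t.
  apply: Phi_inj => //; first exact: algebra_conv_diag.
  rewrite Phi_conv // tP; apply/funext => a; rewrite conv_diagr; last by case: dP.
  have [Pa|nPa] := pselect (supp p a); last by rewrite /P !(cutF _ nPa) mul0r.
  have [z _ za] := hp _ Pa; rewrite /P -za gdom_id za.
  by rewrite !cutT ?mulr1.
have vt : conv (cut (fun=> v) (@gid S1 @` W)) t = cut (fun=> v) (@gid S1 @` W).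
  apply: Phi_inj; [by apply: algebra_conv_diag => //; case: dv|by case: dv|].
  rewrite Phi_conv //; last by case: dv.
  rewrite tP -/p; apply/funext => a; rewrite conv_diagr; last by case: dP.
  have [/eqP ->|pa] := boolP (p a == 0); first by rewrite mul0r.
  have [z _ za] := hp _ pa; rewrite -za gdom_id za.
  by rewrite /P cutT ?mulr1.
have wt : conv w t = w.
  apply/funext => a; rewrite conv_diagr //.
  have [[z Wz <-]|na] := pselect ((@gid S1 @` W) a); last first.
    by rewrite /w (cutF _ na) mul0r.
  rewrite gdom_id; have /= := congr1 (fun f => f (gid z)) vt.
  rewrite conv_diagr // gdom_id cutT; last by exists z.
  have /= := congr1 (fun f => f (gid z)) tt; rewrite conv_diagr // gdom_id.
  case/(hR.2) => ->; last by rewrite !mulr1.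
  by rewrite mulr0 => v0'; rewrite -v0' eqxx in v0.
have := congr1 (fun f => Phi f (gid y)) wt; rewrite Phi_conv //; last by case: dw.
rewrite tP conv_diagr; last by case: dP.
rewrite gdom_id /P cutF ?mulr0 => [w0|]; first by rewrite -w0 eqxx in wy.
by rewrite /supp /= py eqxx.
Qed.

Lemma normalizer_gdom_inj x (m : arr S1 -> R) :
  normalizer_at c1 x m -> set_inj (supp m) (@gdom S1).
Proof.
move=> hm a b; rewrite !inE => ma mb ab.
have am : groupoid_algebra m by case: hm => -[].
have [lm cm] := am.
have [|//|U [bU Ua UO]] := @compact_bisection_basis _ ample1 (ginv a)
    (@ginv S1 @^-1` ([set b | m b = m a] `&` c1 @^-1` [set c1 a])).
- apply/open_ginv_preimage/openI; first exact: open_fiber.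
  by case: hc1 => h _ _; exact: h.
- by rewrite /= ginvK.
have [cU [oU idU irU]] := bU.
pose u : arr S1 -> R := cut (fun=> 1) U.
pose W := @grng S1 @` U; pose K := @gdom S1 @` U.
have cW : compact W by exact: compact_grng_image.
have oW : open W by exact: open_grng_image.
have dw : diagonal (cut (fun=> 1 : R) (@gid S1 @` W)) by exact: diagonal_const.
have de : diagonal (cut (fun=> 1 : R) (@gid S1 @` K)).
  by apply: diagonal_const => //; [exact: compact_gdom_image | exact: open_gdom_image].
set w := cut _ _ in dw; set e := cut _ _ in de.
have [[aw hw] [ae he]] := (dw, de).
have hu : normalizer_at c1 (c1 a)^-1%g u.
  apply: normalizer_at_ind => // d /UO[_ /=]; rewrite grading_inv // => <-.
  by rewrite invgK.
have au : groupoid_algebra u by case: hu => -[].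
have [_ iPu _] := Phi_local_bisection hu.
have [_ iPm _] := Phi_local_bisection hm.
pose m2 := conv m w.
have am2 : groupoid_algebra m2 by exact: algebra_conv_diag.
pose q := conv u m2.
have aq : groupoid_algebra q by exact: algebra_conv_ind.
have [aPw hPw] := Phi_diagonal dw; have [aPe hPe] := Phi_diagonal de.
have m2E d : m2 d = m d * w (gid (gdom d)) by rewrite /m2 conv_diagr.
have Pm2E d : Phi m2 d = Phi m d * Phi w (gid (gdom d)).
  by rewrite /m2 Phi_conv // conv_diagr.
(* The function [q] and the constant [m a] on [W] agree at all units, so [Phi] of their difference
   vanishes at units. Writing the difference as a sum with the constant [- m a] lets additivity of
   [Phi] suffice. *)
have PqE y : Phi q (gid y) = Phi (cut (fun=> m a) (@gid S1 @` W)) (gid y).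
  have dv v : diagonal (cut (fun=> v : R) (@gid S1 @` W)) by exact: diagonal_const.
  have := @Phi_off_units (q \+ cut (fun=> - m a) (@gid S1 @` W)) y.
  rewrite Phi_add //; last by case: (dv (- m a)).
  have : Phi (cut (fun=> m a) (@gid S1 @` W) \+ cut (fun=> - m a) (@gid S1 @` W))
      (gid y) = 0.
    rewrite (_ : _ \+ _ = fun=> 0) ?Phi0 //; apply/funext => d /=.
    have [Wd|nWd] := pselect ((@gid S1 @` W) d).
      by rewrite !(cutT _ Wd) subrr.
    by rewrite !(cutF _ nWd) addr0.
  rewrite Phi_add /=; [|by case: (dv (m a))|by case: (dv (- m a))].
  move=> E /= h; apply: (addIr (Phi (cut (fun=> - m a) (@gid S1 @` W)) (gid y))).
  rewrite E h //; first by apply: algebraD => //; case: (dv (- m a)).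
  move=> z; have [[d Ud dz]|nWz] := pselect (W z).
    rewrite cutT; last by exists z => //; exists d.
    rewrite /q (@conv_ind _ _ nz _ _ _ d) ?grng_id // -dz -gdom_inv gmul_idr.
    rewrite m2E gdom_inv /w cutT; last by exists (grng d) => //; exists d.
    by rewrite mulr1; have [/= -> _] := UO _ Ud; rewrite subrr.
  rewrite cutF; last first.
    move=> [z' Wz' /(congr1 (@gdom S1))]; rewrite !gdom_id => zz.
    by rewrite -zz in nWz.
  by rewrite /q conv_ind_out ?addr0 // grng_id.
(* At the source unit of [d], Phi q is nonzero, so some term of the product is. Source injectivity
   on supp (Phi m) identifies its arrow with [d]; the other factor is Phi u at d^-1. *)
have key d : Phi m2 d != 0 -> Phi u (ginv d) != 0.
  rewrite Pm2E => /mulr_neq0_both[md wd].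
  have := Phi_const_neq0 ma cW oW wd; rewrite -PqE Phi_conv //.
  move=> /conv_neq0[d' [d'd ud' m2d']].
  have d'E : d' = d.
    move: m2d'; rewrite Pm2E => /mulr_neq0_both[md' _].
    by apply: iPm; rewrite ?inE // d'd gdom_id.
  by move: ud'; rewrite d'E -grng_inv gmul_idl.
(* In a nonzero term, d d'^-1 and d'^-1 lie in supp (Phi u) with the same source, so they agree and
   [d] is a unit. *)
have dq : diagonal q.
  apply: Phi_diagonal_inv => //; split; first exact: Phi_algebra.
  rewrite Phi_conv // => d /conv_neq0[d' [d'd ud' /key ud]].
  exists (gdom d') => //; apply/esym/gmulV_inv => //.
  by apply: iPu; rewrite ?inE // gdomK // gdom_inv.
have ue : conv u e = u.
  apply/funext => d; rewrite conv_diagr //.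
  have [Ud|nUd] := pselect (U d); last by rewrite /u (cutF _ nUd) mul0r.
  by rewrite /e [X in _ * X]cutT ?mulr1 //; exists (gdom d) => //; exists d.
have ee : conv e e = e.
  apply/funext => d; rewrite conv_diagr //.
  have [Kd|nKd] := pselect ((@gid S1 @` K) d); last by rewrite /e (cutF _ nKd) mul0r.
  by have [z Kz zd] := Kd; rewrite -zd gdom_id zd /e !(cutT _ Kd) mulr1.
(* Phi e has idempotent values at units. At ranges of arrows in supp (Phi m2), [key] and [ue] make
   the value nonzero, hence 1. *)
have em : conv e m2 = m2.
  apply: Phi_inj => //; first exact: algebra_diag_conv.
  rewrite Phi_conv //; apply/funext => d; rewrite conv_diagl //.
  have [/eqP ->|m2d] := boolP (Phi m2 d == 0); first by rewrite mulr0.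
  have := key _ m2d; rewrite -{1}ue Phi_conv // conv_diagr // gdom_inv.
  move=> /mulr_neq0_both[_].
  have /= := congr1 (fun f => Phi f (gid (grng d))) ee.
  rewrite Phi_conv // conv_diagr // gdom_id => /(hR.2)[->|-> _].
    by rewrite eqxx.
  by rewrite mul1r.
have m2b : m2 b != 0.
  rewrite m2E /w cutT ?mulr1 //; exists (gdom b) => //; exists (ginv a) => //.
  by rewrite grng_inv.
have : conv e m2 b != 0 by rewrite em.
rewrite conv_diagl // => /mulr_neq0_both[/cut_neq0[[_ [d Ud <-] dr] _] _].
have db : gdom d = grng b.
  by have := congr1 (@gdom S1) dr; rewrite !gdom_id.
(* This value is [m2 b]. As [q] is diagonal, d b is a unit and b = d^-1; then [d] and a^-1 are
   arrows of [U] with the same range. *)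
have : q (gmul d b) != 0.
  by rewrite /q (@conv_ind _ _ nz _ _ _ d) ?grng_mul ?gmulVK.
move=> /dq.2[z _ /esym dbz]; have bE := gmul_idV db dbz.
rewrite bE -(ginvK a); congr ginv; apply: irU; rewrite ?inE //.
by rewrite grng_inv ab bE gdom_inv.
Qed.

(** Fix [a] in supp m and take [d] in supp m' with source r(a). For every [b] in supp m with range
    r(a), m' m is nonzero at d b; being diagonal, it forces d b to be a unit, so b = d^-1. *)
Lemma normalizer_grng_inj x (m : arr S1 -> R) :
  normalizer_at c1 x m -> set_inj (supp m) (@grng S1).
Proof.
move=> hm; have [cm [m' [cm' e1 e2 d1 d2]]] := hm.
have [[am _] [am' _]] := (cm, cm').
have hm' : normalizer_at c1 x^-1%g m'.
  by split => //; exists m; rewrite invgK; split.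
have dinj := normalizer_gdom_inj hm; have dinj' := normalizer_gdom_inj hm'.
have [_ hmm'] := diagonal_conv_inverse ample1 haus1 am d1.
have [_ hm'm] := diagonal_conv_inverse ample1 haus1 am' d2.
have mE a : conv m m' (gid (grng a)) * m a = m a.
  by have /= := congr1 (fun f => f a) e1; rewrite conv_diagl.
suff key a : supp m a ->
    exists d, forall b, supp m b -> grng b = grng a -> b = ginv d.
  move=> a b; rewrite !inE => ma mb ab; have [d hd] := key a ma.
  exact: etrans (hd a ma erefl) (esym (hd b mb (esym ab))).
move=> ma; have : conv m m' (gid (grng a)) != 0.
  by have := ma; rewrite /supp /= -{1}mE => /mulr_neq0_both[].
move=> /conv_neq0[d [dE _ m'd]]; rewrite gdom_id in dE.
exists d => b mb ba; have db : gdom d = grng b by rewrite ba.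
have : conv m' m (gmul d b) != 0.
  rewrite (@conv_injr _ _ _ _ _ b) ?gmulK ?gdom_mul //.
  (* As R may have zero divisors, m'(d) m(b) is seen to be nonzero from m(b) = m(d^-1) m'(d) m(b),
     where source injectivity on supp m' reduces m m' to one term. *)
  have := mb; rewrite /supp /= -{1}mE (@conv_injr _ _ _ _ _ d) ?gdom_id //.
  by rewrite -mulrA => /mulr_neq0_both[].
by move=> /hm'm[z _ /esym]; exact: gmul_idV.
Qed.

End Isomorphism.

Theorem theorem5p5 (G : groupType) (R : comPzRingType) (S1 S2 : topGroupoid)
    (c1 : arr S1 -> G) (c2 : arr S2 -> G)
    (hR : indecomposable R)
    (ample1 : ample S1) (ample2 : ample S2)
    (hausdorff1 : hausdorff_groupoid S1) (hausdorff2 : hausdorff_groupoid S2)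
    (hc1 : grading c1) (hc2 : grading c2)
    (lbh2 : local_bisection_hypothesis R c2)
    (hPhi : exists Phi : (arr S1 -> R) -> (arr S2 -> R),
      [/\ ring_isomorphism Phi, diagonal_preserving Phi
        & graded_map c1 c2 Phi]) :
  local_bisection_hypothesis R c1.
Proof.
have [Phi [Phi_iso Phi_diag Phi_graded]] := hPhi.
move=> m [x _ hm]; split.
- by case: hm => -[[/open_supp]].
- exact: (normalizer_gdom_inj hR ample1 ample2 hausdorff1 hausdorff2 hc1
    lbh2 Phi_iso Phi_diag Phi_graded hm).
- exact: (normalizer_grng_inj hR ample1 ample2 hausdorff1 hausdorff2 hc1
    lbh2 Phi_iso Phi_diag Phi_graded hm).
Qed.
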